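(* Let $G$ be a finite $2$-group. Then $G$ is a $\mathcal{DC}$-group if and only if either $G'$ is cyclic, or $G'\cong \mathrm{C}_2^2$ and $\mathrm{cl}(G)=3$.
   Context: For a group $H$, $H'$ denotes its derived (commutator) subgroup. A group $G$ is called a $\mathcal{DC}$-group if the set $\{H' \mid H\leq G\}$ is a chain with respect to inclusion, i.e. for all subgroups $H,K\leq G$ one has $H'\leq K'$ or $K'\leq H'$. $\mathrm{cl}(G)$ denotes the nilpotency class of $G$, and $\mathrm{C}_2^2$ the direct product of two cyclic groups of order $2$. *)

(* Defs.v *)
From mathcomp Require Import all_boot all_order all_algebra all_fingroup all_solvable.

Set Implicit Arguments.
Unset Strict Implicit.
Unset Printing Implicit Defensive.

Local Open Scope group_scope.

Definition DC_group (gT : finGroupType) (G : {group gT}) : Prop :=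
  forall H K : {group gT}, H \subset G -> K \subset G ->
    H^`(1) \subset K^`(1) \/ K^`(1) \subset H^`(1).

(* The group law on ['Z_2 * 'Z_2] is componentwise addition modulo 2. *)
Definition C2xC2 : {group ('Z_2 * 'Z_2)%type} := [set: ('Z_2 * 'Z_2)%type]%G.

(* Main.v *)
Require Import Defs.
From mathcomp Require Import all_boot all_order all_algebra all_fingroup all_solvable.

(* If G' is cyclic, the derived subgroups lie in a cyclic 2-group.  If G' has
   order 4 and G has class 3, put C = C_G(G') and let L_i be the lower central
   series.  The three subgroups lemma makes C' central in G.  A derived subgroup
   H' of order 2 other than L_3 would give H <= C and G' = H' L_3, so G' would
   be central; hence L_3 is the only derived subgroup of order 2.

   Conversely let G be DC with G' noncyclic.  The largest <x, y>' contains every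
   commutator, so G' = <x, y>' and one may take G = <x, y>.  Factoring out
   central subgroups of order 2 reduces |G'| > 4 to |G'| = 8, which is ruled
   out by exhibiting two distinct commutators of order 2, each commuting with
   its own two entries (for such a commutator <a, b>' = <[a, b]>).  With c = [x, y]:
   - if |L_3| = 4 and L_4 = 1, use [c, x] and [c, y];
   - otherwise |L_3 : L_4| = 2, and x, y can be chosen with [c, x] in L_4 and
     d = [c, y] not in L_4; then [x, y^2] = c^2 d is compared with
     [x^2, y] = c^2 when L_4 = 1, and with [d, y] when |L_4| = 2. *)

Set Implicit Arguments.
Unset Strict Implicit.
Unset Printing Implicit Defensive.

Local Open Scope group_scope.

Section DCgroups.

Variable gT : finGroupType.
Implicit Types (G H K S : {group gT}) (x y a b c w : gT).

(** * Inheritance of the chain condition, and its effect on commutators *)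

Lemma DC_groupS G H : H \subset G -> DC_group G -> DC_group H.
Proof. by move=> sHG dcG A B sA sB; apply: dcG; apply: subset_trans sHG. Qed.

Lemma DC_quotient G S : S <| G -> DC_group G -> DC_group (G / S)%G.
Proof.
move=> nsSG dcG.
have lift (A : {group coset_of S}) : A \subset G / S ->
    exists2 B : {group gT}, B \subset G & A^`(1) = B^`(1) / S.
  move=> sA; exists (coset S @*^-1 A)%G.
    by rewrite -(quotientGK nsSG) morphpreS.
  by rewrite quotient_der ?subsetIl //= cosetpreK.
move=> _ _ /lift[A sA ->] /lift[B sB ->].
by case: (dcG A B sA sB) => sAB; [left | right]; apply: quotientS.
Qed.

(* By [der1_joing_cycles] the hypotheses on [w] say that [<a, b>' = <w>]. *)
Lemma DC_commg_eq G a b a' b' w w' :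
    DC_group G -> a \in G -> b \in G -> a' \in G -> b' \in G ->
    [~ a, b] = w -> commute w a -> commute w b -> #[w] = 2 ->
    [~ a', b'] = w' -> commute w' a' -> commute w' b' -> #[w'] = 2 ->
  w = w'.
Proof.
move=> dcG Ga Gb Ga' Gb' ew cwa cwb ow ew' cwa' cwb' ow'.
have der (u v t : gT) : [~ u, v] = t -> commute t u -> commute t v ->
    (<[u]> <*> <[v]>)^`(1) = <[t]>.
  move=> <- ctu ctv; apply: der1_joing_cycles.
  by rewrite -sub_cent1 join_subG !cycle_subG; apply/andP; split; apply/cent1P.
have inG u v : u \in G -> v \in G -> <[u]> <*> <[v]> \subset G.
  by move=> Gu Gv; rewrite join_subG !cycle_subG Gu.
have nt_mem u v : #[u] = 2 -> #[v] = 2 -> u \in <[v]> -> u = v.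
  move=> ou /cycle2g->; rewrite !inE => /predU1P[u1 | /eqP//].
  by rewrite u1 order1 in ou.
have:= dcG _ _ (inG _ _ Ga Gb) (inG _ _ Ga' Gb').
rewrite (der _ _ _ ew) // (der _ _ _ ew') // !cycle_subG.
by case=> /nt_mem-> //.
Qed.

Lemma DC_der1_two_gen G : DC_group G ->
  exists x y, [/\ x \in G, y \in G & G^`(1) = <<[set x; y]>>^`(1)].
Proof.
move=> dcG; pose D (u : gT * gT) := <<[set u.1; u.2]>>^`(1).
have [|[x y] /= /andP[Gx Gy] maxD] :=
    @arg_maxnP _ (1, 1) (fun u => (u.1 \in G) && (u.2 \in G)) (fun u => #|D u|).
  by rewrite group1.
have sDG u v : u \in G -> v \in G -> <<[set u; v]>> \subset G.
  by move=> Gu Gv; rewrite gen_subG subUset !sub1set Gu.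
exists x, y; split=> //; apply/eqP.
rewrite eqEsubset (dergS 1 (sDG x y Gx Gy)) andbT.
rewrite gen_subG; apply/subsetP=> _ /imset2P[a b Ga Gb ->].
have sDxy : D (a, b) \subset D (x, y).
  case: (dcG _ _ (sDG _ _ Ga Gb) (sDG _ _ Gx Gy)) => //= sD.
  have /eqP-> // : D (a, b) == D (x, y).
  by rewrite eq_sym eqEcard sD maxD //= Ga.
by apply: (subsetP sDxy); rewrite mem_commg ?mem_gen ?set21 ?set22.
Qed.

(** * Commutators and lower central terms of two-generator groups *)

Lemma commg_mod_gen G S x y c :
    S <| G -> <<[set x; y]>> = G -> c \in G ->
    [~ c, x] \in S -> [~ c, y] \in S ->
  {in G, forall g, [~ c, g] \in S}.
Proof.
move=> nsSG defG Gc Scx Scy g Gg; have nSG := normal_norm nsSG.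
(* The elements commuting with [c] modulo [S] form a subgroup, so only the two generators need
   testing. *)
have sG : G \subset coset S @*^-1 'C[coset S c].
  have [Gx Gy] : x \in G /\ y \in G by rewrite -defG !mem_gen ?set21 ?set22.
  rewrite -defG gen_subG; apply/subsetP=> z xyz.
  have [Nc Nz] : c \in 'N(S) /\ z \in 'N(S).
    by split; apply: (subsetP nSG) => //; case/set2P: xyz => ->.
  rewrite mem_morphpre //; apply/cent1P/commute_sym/commgP.
  by rewrite -morphR //= coset_id //; case/set2P: xyz => ->.
case/morphpreP: (subsetP sG g Gg) => Ng /cent1P/commute_sym/commgP.
have Nc := subsetP nSG c Gc; rewrite -morphR // => /eqP/coset_idr-> //.
by rewrite groupR.
Qed.

Lemma der1_sub_gen G S x y :
  S <| G -> <<[set x; y]>> = G -> [~ x, y] \in S -> G^`(1) \subset S.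
Proof.
move=> nsSG defG Sxy; have nSG := normal_norm nsSG.
have [Gx Gy] : x \in G /\ y \in G by rewrite -defG !mem_gen ?set21 ?set22.
have comm_y g : g \in G -> [~ y, g] \in S.
  apply: (commg_mod_gen nsSG defG) => //; last by rewrite commgg.
  by rewrite -invg_comm groupV.
have comm_x g : g \in G -> [~ x, g] \in S.
  by apply: (commg_mod_gen nsSG defG) => //; rewrite commgg.
rewrite gen_subG; apply/subsetP=> _ /imset2P[a b Ga Gb ->].
by apply: (commg_mod_gen nsSG defG _ _ _ Gb); rewrite // -invg_comm groupV;
  [apply: comm_x | apply: comm_y].
Qed.

Lemma lcn3_sub_gen G S x y c :
    S <| G -> <<[set x; y]>> = G -> c = [~ x, y] ->
    [~ c, x] \in S -> [~ c, y] \in S ->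
  'L_3(G) \subset S.
Proof.
move=> nsSG defG def_c Scx Scy; have nSG := normal_norm nsSG.
have [Gx Gy] : x \in G /\ y \in G by rewrite -defG !mem_gen ?set21 ?set22.
have Gc : c \in G by rewrite def_c groupR.
have nsZ : (coset S @*^-1 'Z(G / S)) <| G.
  by rewrite -{2}(quotientGK nsSG) cosetpre_normal center_normal.
rewrite lcnSn -quotient_cents2 ?lcn_norm ?(subset_trans (lcn_sub 2 G)) //.
have sub_pre : 'L_2(G) \subset coset S @*^-1 'Z(G / S).
  apply: (der1_sub_gen nsZ defG); rewrite -def_c.
  have Nc := subsetP nSG c Gc.
  rewrite mem_morphpre // inE mem_quotient //.
  apply/centP=> _ /morphimP[g Ng Gg ->].
  apply/commgP; rewrite -morphR //= coset_id //.
  exact: (commg_mod_gen nsSG defG Gc Scx Scy).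
have:= quotientS S sub_pre; rewrite [_ / _ in X in _ \subset X]cosetpreK.
by move/subset_trans; apply; apply: subsetIr.
Qed.

(** The product is normal because its commutators with [G] already lie in ['L_3(G)], and modulo it
    the two generators commute. *)
Lemma der1_two_gen G x y c : <<[set x; y]>> = G -> c = [~ x, y] ->
  G^`(1) = <[c]> * 'L_3(G).
Proof.
move=> defG def_c.
have [Gx Gy] : x \in G /\ y \in G by rewrite -defG !mem_gen ?set21 ?set22.
have G'c : c \in G^`(1) by rewrite def_c mem_commg.
have nLc : <[c]> \subset 'N('L_3(G)).
  by rewrite (subset_trans _ (lcn_norm 3 G)) // cycle_subG def_c groupR.
have sM : <[c]> <*> 'L_3(G) \subset G^`(1).
  by rewrite join_subG cycle_subG G'c (lcn_subS 2).
rewrite -norm_joinEl //; apply/eqP; rewrite eqEsubset sM andbT.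
apply: (der1_sub_gen _ defG); last by rewrite -def_c mem_gen // inE cycle_id.
rewrite /normal (subset_trans sM) ?der_sub //= -commg_subl.
rewrite (subset_trans (commSg G sM)) // -(lcnSn 1) joing_subr //.
Qed.

(** By the three subgroups lemma ['L_3(G)] centralizes [G^](1)[, and the quotient of]G^[(1)] by it
    is cyclic, generated by the image of [[~ x, y]]. *)
Lemma lcn5_der1_abelian G x y :
  <<[set x; y]>> = G -> 'L_5(G) = 1 -> abelian G^`(1).
Proof.
move=> defG L5; have eL5 : [~: 'L_3(G), G, G] = 1 by rewrite -!lcnSn.
have /commG1P cL3 : [~: G, G, 'L_3(G)] = 1.
  by apply: three_subgroup => //; rewrite (commGC G).
apply: (@cyclic_factor_abelian _ 'L_3(G)%G).
  by rewrite subsetI (lcn_subS 2) /= centsC.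
rewrite /= (der1_two_gen defG (erefl _)) quotientMidr quotient_cyclic //.
exact: cycle_cyclic.
Qed.

Lemma mulg_index2 H K a b :
    H \subset K -> #|K| = (2 * #|H|)%N -> a \in K -> b \in K ->
  a \notin H -> b \notin H -> a * b \in H.
Proof.
move=> sHK oK Ka Kb nHa nHb.
have iHK : #|K : H| = 2 by rewrite -divgS // oK mulnK.
have: a \in H :* b^-1.
  by rewrite (rcoset_index2 sHK iHK) !inE ?groupV ?nHb ?nHa ?Ka ?Kb.
by rewrite mem_rcoset invgK.
Qed.

(** Nilpotency makes the inclusion proper, so its index is a positive power of [p]. *)
Lemma lcn_card_dvd (p : nat) G n : p.-group G -> 'L_n.+1(G) :!=: 1 ->
  (p * #|'L_n.+2(G)| %| #|'L_n.+1(G)|)%N.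
Proof.
move=> pG ntL; have ntG : G :!=: 1.
  by apply: contraNneq ntL => G1; rewrite -subG1 -G1 lcn_sub.
have [p_pr _ _] := pgroup_pdiv pG ntG.
have pL : 'L_n.+2(G) \proper 'L_n.+1(G).
  apply: nil_comm_properl (pgroup_nil pG) (lcn_sub _ _) ntL _.
  by rewrite subsetI subxx lcn_norm.
rewrite -(Lagrange (proper_sub pL)) mulnC dvdn_pmul2l ?cardG_gt0 //.
have /(pgroupS (lcn_sub n.+1 G))pLn := pG.
have [k ik] := p_natP (pnat_dvd (dvdn_indexg _ 'L_n.+2(G)) pLn).
case: k ik => [|k ->]; last by rewrite dvdn_exp.
by move/eqP; rewrite indexg_eq1 (negPf (proper_subn pL)).
Qed.

(** For no generating pair are both commutators in ['L_4(G)], since that would put ['L_3(G)] inside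
    ['L_4(G)]. If only the second is, the generators are swapped; if neither is, [x] is replaced by
    [x * y]. *)
Lemma two_gen_choice G x y :
    <<[set x; y]>> = G -> #|'L_3(G)| = (2 * #|'L_4(G)|)%N ->
  exists x' y', [/\ <<[set x'; y']>> = G, [~ x', y', x'] \in 'L_4(G)
                  & [~ x', y', y'] \notin 'L_4(G)].
Proof.
move=> defG oL3; have nL4G := lcn_norm 4 G; have nsL4 := lcn_normal 4 G.
have part a b : <<[set a; b]>> = G -> [~ a, b, a] \in 'L_4(G) ->
    [~ a, b, b] \notin 'L_4(G).
  move=> defG' L4a; apply/negP=> L4b.
  have := lcn3_sub_gen nsL4 defG' (erefl _) L4a L4b.
  by move/subset_leq_card; rewrite oL3 leqNgt ltn_Pmull.
have [Gx Gy] : x \in G /\ y \in G by rewrite -defG !mem_gen ?set21 ?set22.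
set c := [~ x, y].
have Gc : c \in G by rewrite groupR.
have inL3 g : g \in G -> [~ c, g] \in 'L_3(G).
  by move=> Gg; rewrite lcnSn mem_commg // lcn2 mem_commg.
have L4J u g : g \in G -> (u ^ g \in 'L_4(G)) = (u \in 'L_4(G)).
  by move=> Gg; rewrite memJ_norm // (subsetP nL4G).
have [L4x | nL4x] := boolP ([~ c, x] \in 'L_4(G)).
  by exists x, y; split=> //; apply: part.
have [L4y | nL4y] := boolP ([~ c, y] \in 'L_4(G)).
  have defG' : <<[set y; x]>> = G by rewrite setUC.
  have L4y' : [~ y, x, y] \in 'L_4(G).
    have -> : [~ y, x, y] = ([~ c, y] ^ c^-1)^-1.
      rewrite -[[~ y, x]]invg_comm -/c !commgEl conjVg (conjgE _ c^-1) !invMg !invgK.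
      by rewrite !mulgA !(mulgK, mulgKV).
    by rewrite groupV L4J ?groupV.
  by exists y, x; split=> //; apply: part.
have defG' : <<[set x * y; y]>> = G.
  apply/eqP; rewrite eqEsubset gen_subG subUset !sub1set groupM //= Gy.
  rewrite -defG gen_subG subUset !sub1set (mem_gen (set22 _ _)) andbT.
  by rewrite -{1}(mulgK y x) groupM ?groupV ?mem_gen ?set21 ?set22.
(* This is the conjugate by [y] of [[~ c, y * x]], a product of [[~ c, x]] and a conjugate of
   [[~ c, y]]; both factors lie outside the index 2 subgroup ['L_4(G)] of ['L_3(G)]. *)
have L4xy : [~ x * y, y, x * y] \in 'L_4(G).
  have -> : [~ x * y, y] = c ^ y by rewrite commMgJ commgg mulg1.
  have -> : x * y = (y * x) ^ y by rewrite conjgE !mulgA mulVg mul1g.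
  rewrite -conjRg L4J // commgMJ (mulg_index2 (lcn_subS 3 G) oL3) ?inL3 ?L4J //.
  by rewrite memJ_norm ?inL3 // (subsetP (lcn_norm 3 G)).
by exists (x * y), y; split=> //; apply: part.
Qed.

(** * Two generators and a derived subgroup of order 8 *)

Lemma DC_two_gen_card8 G x y :
    DC_group G -> 2.-group G -> <<[set x; y]>> = G -> #|G^`(1)| = 8 ->
  cyclic G^`(1).
Proof.
move=> dcG pG defG oG'; case: (boolP (cyclic _)) => // ncG'.
have dvd_next n : ('L_n.+2(G) : {set gT}) != 1 ->
    (2 * #|'L_n.+3(G)| %| #|'L_n.+2(G)|)%N := @lcn_card_dvd 2 G n.+1 pG.
have expG' a : a \in G^`(1) -> a ^+ 4 = 1.
  move=> G'a; have /(@dvdn_pfactor 2 _ 3 isT)[k le_k3 oa] : #[a] %| 2 ^ 3.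
    by rewrite -[(2 ^ 3)%N]oG' order_dvdG.
  rewrite leq_eqVlt in le_k3; case/predU1P: le_k3 => [k3 | lt_k3]; last first.
    by apply/eqP; rewrite -order_dvdn oa (@dvdn_exp2l 2 k 2).
  case/negP: ncG'; have <- : <[a]> = G^`(1); last exact: cycle_cyclic.
  by apply/eqP; rewrite eqEcard cycle_subG G'a oG' -orderE oa k3.
have ntL3 : ('L_3(G) : {set gT}) != 1.
  apply: contraNneq ncG' => L3; rewrite (der1_two_gen defG (erefl _)) L3 mulg1.
  exact: cycle_cyclic.
have dvdL3 : #|'L_3(G)| %| 4.
  by have := dvd_next 0%N; rewrite oG' -[8]/(2 * 4)%N dvdn_pmul2l //; apply;
     rewrite -cardG_gt1 oG'.
have dvdL4 := dvd_next 1%N ntL3.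
have L3_gt1 : (1 < #|'L_3(G)|)%N by rewrite cardG_gt1.
have sqL3 a : #|'L_3(G)| = 4 -> a \in G^`(1) -> a ^+ 2 \in 'L_3(G).
  move=> oL3 G'a; have [L3a | nL3a] := boolP (a \in 'L_3(G)); first exact/groupX.
  by rewrite (mulg_index2 (lcn_subS 2 G)) // oL3; apply: oG'.
have inL3 a g : a \in G^`(1) -> g \in G -> [~ a, g] \in 'L_3(G).
  by move=> G'a Gg; rewrite lcnSn mem_commg.
have inL4 a g : a \in 'L_3(G) -> g \in G -> [~ a, g] \in 'L_4(G).
  by move=> G'a Gg; rewrite lcnSn mem_commg.
have cenL n a g : ('L_n.+2(G) : {set gT}) = 1 -> a \in 'L_n.+1(G) -> g \in G ->
    commute a g.
  by rewrite lcnSn => /commG1P/centsP cL La Gg; apply: cL.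
have genG u v : <<[set u; v]>> = G ->
    [/\ u \in G, v \in G & [~ u, v] \in G^`(1)].
  move=> defG'.
  have [Gu Gv] : u \in G /\ v \in G by rewrite -defG' !mem_gen ?set21 ?set22.
  by rewrite Gu Gv mem_commg.
(* The orders of ['L_3(G)] and ['L_4(G)] can only be 2 and 1, 4 and 2, or 4 and 1; the first two
   cases share the choice of generators. *)
have [oL3 | [oL3 oL4]] : #|'L_3(G)| = (2 * #|'L_4(G)|)%N
    \/ #|'L_3(G)| = 4 /\ #|'L_4(G)| = 1%N.
- move: dvdL3 dvdL4 L3_gt1; move: #|'L_3(G)| #|'L_4(G)| => m k; rewrite mul2n.
  case: m => [|[|[|[|[|m]]]]] // _ => [k_dvd1 _ | k_dvd2 _].
    by left; case: k k_dvd1 => [|[|k]].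
  by case: k k_dvd2 => [|[|[|k]]] //; [right | left].
- have [{}x [{}y [{}defG L4x nL4y]]] := two_gen_choice defG oL3.
  set c := [~ x, y] in L4x nL4y; set d := [~ c, y] in nL4y.
  have [Gx Gy G'c] := genG x y defG; rewrite -/c in G'c.
  have Gc : c \in G by rewrite groupR.
  have L3d : d \in 'L_3(G) by exact: inL3.
  have cy : c ^ y = c * d by rewrite conjg_mulR.
  have L5 : ('L_5(G) : {set gT}) = 1.
    apply/trivgP; have [L4 | ntL4] := eqVneq ('L_4(G) : {set gT}) 1.
      by rewrite -L4 (lcn_subS 4).
    have oL4 : #|'L_4(G)| %| 2 by rewrite -(@dvdn_pmul2l 2) // -oL3.
    have := dvdn_trans (dvd_next 2%N ntL4) oL4.
    rewrite -[2 in X in _ %| X]muln1 dvdn_pmul2l // => oL5.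
    by rewrite -(card_le1_trivg (dvdn_leq _ oL5)).
  have cAA : {in G^`(1) &, forall a b, commute a b}.
    by move=> a b G'a; apply: (centsP (lcn5_der1_abelian defG L5)).
  have G'd : d \in G^`(1) by rewrite (subsetP (lcn_subS 2 G)).
  have G't : [~ c, x] \in G^`(1) by rewrite (subsetP (lcn_subS 2 G)) ?inL3.
  have ccd : commute c d by apply: cAA.
  have cL4 := cenL 3%N _ _ L5.
  (* Conjugating [c ^ y = c * d] by [x], where [c ^ x] differs from [c] by a
     central element and [y ^ x = y * c^-1], gives [d ^ x = d]. *)
  have dx : commute d x.
    apply/commgP/conjg_fixP; apply: (mulgI (c ^ x)).
    rewrite -conjMg -cy conjJg [c ^ x]conjg_mulR [y ^ x]conjg_mulR (conjgM _ y).
    rewrite -[[~ y, x]]invg_comm -/c (conjMg c) cy.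
    have -> : [~ c, x] ^ y = [~ c, x] by apply/conjg_fixP/commgP/cL4.
    have -> : (c * d * [~ c, x]) ^ c^-1 = c * d * [~ c, x].
      apply/conjg_fixP/commgP.
      exact: cAA (groupM (groupM G'c G'd) G't) (groupVr G'c).
    rewrite -(mulgA c) -[RHS](mulgA c); congr (c * _); exact: cAA.
  have sq_cy : [~ c ^+ 2, y] = d ^+ 2 by apply: commXg.
  have wE : [~ x, y ^+ 2] = c ^+ 2 * d.
    by rewrite expgS expg1 commgMJ -/c cy mulgA.
  have c4 : (c ^+ 2) ^+ 2 = 1 by rewrite -expgM expG'.
  have ord2 a : a != 1 -> a ^+ 2 = 1 -> #[a] = 2.
    by move=> nt_a a2; apply: nt_prime_order.
  have sq_w : d ^+ 2 = 1 -> (c ^+ 2 * d) ^+ 2 = 1.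
    move=> d2; rewrite expgMn ?c4 ?d2 ?mulg1 //.
    exact/commute_sym/commuteX/commute_sym.
  have [L4 | ntL4] := eqVneq ('L_4(G) : {set gT}) 1.
    have cL3 := cenL 2%N _ _ L4.
    have cx : commute c x by apply/commgP; move: L4x; rewrite L4 inE.
    have ntd : d != 1 by rewrite L4 inE in nL4y.
    have oL3' : #|'L_3(G)| = 2 by rewrite oL3 L4 cards1.
    have d2 : d ^+ 2 = 1.
      by apply/eqP; rewrite -order_dvdn -oL3' order_dvdG.
    have cyy : commute (c ^+ 2) y by apply/commgP; rewrite sq_cy d2.
    (* As [<[c]> * 'L_3(G)] has order 8, ['L_3(G)] has order 2 and [c] has order at most 4, the
       order of [c] is exactly 4 and the two factors meet trivially. *)
    have nL3c2 : c ^+ 2 \notin 'L_3(G).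
      have le_c : #|<[c]>| <= 4.
        by rewrite -orderE dvdn_leq // order_dvdn (expG' c G'c) eqxx.
      have oI : (8 * #|<[c]> :&: 'L_3(G)| = #|<[c]> | * 2)%N.
        have := mul_cardG <[c]> 'L_3(G).
        by rewrite oL3' -(der1_two_gen defG (erefl _)) oG' => <-.
      have tiI : <[c]> :&: 'L_3(G) = 1.
        apply: card_le1_trivg; rewrite -(@leq_pmul2l 8) // oI.
        exact: leq_mul le_c (leqnn 2).
      apply/negP=> L3c2; have c2 : c ^+ 2 = 1.
        by apply/set1gP; rewrite -tiI inE mem_cycle.
      have: #|<[c]>| <= 2 by rewrite -orderE dvdn_leq // order_dvdn c2 eqxx.
      by rewrite -(@leq_pmul2r 2) // -oI tiI cards1.
    have ec : c ^+ 2 * d = c ^+ 2.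
      apply: (DC_commg_eq dcG Gx (groupX 2 Gy) (groupX 2 Gx) Gy wE).
      - apply/commute_sym/commuteM/commute_sym/cL3 => //.
        by apply/commuteX/commute_sym.
      - by apply/commuteX/commute_sym/commuteM/commute_sym/cL3.
      - apply: ord2 (sq_w d2); apply: contra nL3c2 => /eqP e.
        by rewrite -(mulgK d (c ^+ 2)) e mul1g groupV.
      - by rewrite expgS expg1 commMgJ -/c (conjg_fixP (introT commgP cx)).
      - by apply/commuteX/commute_sym/commuteX/commute_sym.
      - by [].
      by apply: ord2 c4; apply: contraNneq nL3c2 => ->; apply: group1.
    by case/eqP: ntd; apply: (mulgI (c ^+ 2)); rewrite mulg1.
  have oL4 : #|'L_4(G)| = 2.
    have: #|'L_4(G)| %| 2 by rewrite -(@dvdn_pmul2l 2) // -oL3.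
    by case/primeP: (isT : prime 2) => _ dv2 /dv2 /pred2P[/eqP|//];
      rewrite -trivg_card1 (negPf ntL4).
  have sqL4 a : a \in 'L_4(G) -> a ^+ 2 = 1.
    by move=> L4a; apply/eqP; rewrite -order_dvdn -oL4 order_dvdG.
  set z := [~ d, y]; have L4z : z \in 'L_4(G) by exact: inL4.
  (* Since [d] commutes with [x], triviality of [z] would make [d] central. Then ['L_3(G)], the
     union of the central ['L_4(G)] and its coset by [d], would be central, forcing ['L_4(G)] to be
     trivial. *)
  have ntz : z != 1.
    apply: contraNneq ntL4 => z1; have dy : commute d y by apply/commgP/eqP.
    have dG g : g \in G -> commute d g.
      move=> Gg; apply/cent1P; rewrite cent1C; apply: subsetP g Gg.
      by rewrite -defG gen_subG subUset !sub1set; apply/andP; split; apply/cent1P.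
    rewrite lcnSn; apply/eqP/commG1P/centsP=> a L3a g Gg.
    have [L4a | nL4a] := boolP (a \in 'L_4(G)); first exact: cL4.
    rewrite -(mulKg d a); apply/commute_sym/commuteM; apply/commute_sym.
      exact/commute_sym/commuteV/commute_sym/dG.
    by apply: cL4 => //; apply: (mulg_index2 (lcn_subS 3 G) oL3).
  (* Otherwise [c ^+ 2 * d] lies in ['L_4(G)] and squares to 1, so [d ^+ 2 = 1] and [c ^+ 2]
     commutes with [y]; then so does [d], against [z != 1]. *)
  have L4c2 : c ^+ 2 \in 'L_4(G).
    apply: contraNT ntz => nL4c2.
    have L4s : c ^+ 2 * d \in 'L_4(G).
      apply: (mulg_index2 (lcn_subS 3 G) oL3) => //; apply: sqL3 => //.
      by rewrite oL3 oL4.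
    have d2 : d ^+ 2 = 1.
      have := sqL4 _ L4s; rewrite expgMn ?c4 ?mul1g //.
      exact/commute_sym/commuteX/commute_sym.
    have cyy : commute (c ^+ 2) y by apply/commgP; rewrite sq_cy d2.
    apply/commgP; rewrite -(mulKg (c ^+ 2) d); apply/commute_sym/commuteM.
      by apply/commuteV/commute_sym.
    by apply/commute_sym/cL4.
  have d2 : d ^+ 2 = 1.
    by rewrite -sq_cy; apply/eqP/commgP/cL4.
  have cd2 : commute d (y ^+ 2).
    apply/commgP; rewrite commgX -/z ?sqL4 //; apply/commute_sym; exact: cL4.
  have nL4w : c ^+ 2 * d \notin 'L_4(G) by rewrite groupMl.
  case/negP: nL4w; suffices -> : c ^+ 2 * d = z by [].
  apply: (DC_commg_eq dcG Gx (groupX 2 Gy) _ Gy wE _ _ _ (erefl z)).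
  - exact: (subsetP (lcn_sub 3 G)).
  - by apply/commute_sym/commuteM/commute_sym => //; apply/commute_sym/cL4.
  - apply/commute_sym/commuteM/commute_sym => //.
    by apply/commute_sym/cL4 => //; apply: groupX.
  - apply: ord2 (sq_w d2); apply: contraNneq nL4y => e.
    by rewrite -(mulKg (c ^+ 2) d) e mulg1 groupV.
  - by apply: cL4 => //; apply: (subsetP (lcn_sub 3 G)).
  - exact: cL4.
  by apply: ord2 => //; apply: sqL4.
have L4 : ('L_4(G) : {set gT}) = 1 by apply/eqP; rewrite trivg_card1 oL4.
set c := [~ x, y].
have [Gx Gy G'c] := genG x y defG; rewrite -/c in G'c.
have Gc : c \in G by rewrite groupR.
(* Such a [<[w]>] is central, hence normal, so it would contain the whole of ['L_3(G)], which has
   order 4. *)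
have notL3 w : w \in 'L_3(G) -> w ^+ 2 = 1 -> [~ c, x] \in <[w]> ->
    [~ c, y] \in <[w]> -> False.
  move=> L3w w2 wx wy; have nsw : <[w]> <| G.
    rewrite /normal cycle_subG (subsetP (lcn_sub 3 G)) //=.
    rewrite cents_norm // centsC cycle_subG; apply/centP=> g Gg.
    exact: (cenL 2).
  have /subset_leq_card := lcn3_sub_gen nsw defG (erefl _) wx wy.
  rewrite oL3 -orderE => /leq_trans/(_ (dvdn_leq (isT : 0 < 2) _)).
  by rewrite order_dvdn w2 eqxx => /(_ isT).
(* The square equals [[~ c ^+ 2, g]], and [c ^+ 2] lies in the central subgroup ['L_3(G)]. *)
have sq_commg g : g \in G -> [~ c, g] ^+ 2 = 1.
  move=> Gg; rewrite -commXg; first last.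
    by apply: commute_sym; apply: (cenL 2); rewrite ?inL3.
  by apply/eqP/commgP; apply: (cenL 2); rewrite ?sqL3.
have cL3 g h : g \in G -> h \in G -> commute [~ c, g] h.
  by move=> Gg Gh; apply: (cenL 2); rewrite ?inL3.
have [cx1 | ntcx] := eqVneq [~ c, x] 1.
  by case: (notL3 [~ c, y]); rewrite ?inL3 ?sq_commg ?cycle_id // cx1 group1.
have [cy1 | ntcy] := eqVneq [~ c, y] 1.
  by case: (notL3 [~ c, x]); rewrite ?inL3 ?sq_commg ?cycle_id // cy1 group1.
have ord2 g : g \in G -> [~ c, g] != 1 -> #[[~ c, g]] = 2.
  by move=> Gg nt1; apply: nt_prime_order; rewrite ?sq_commg.
have exy : [~ c, x] = [~ c, y].
  by apply: (DC_commg_eq dcG Gc Gx Gc Gy) => //; (apply: cL3 || apply: ord2).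
by case: (notL3 [~ c, x]); rewrite ?inL3 ?sq_commg // ?cycle_id // -exy cycle_id.
Qed.

End DCgroups.

(** * Reduction of a noncyclic derived subgroup to order 4 *)

Lemma DC_der1_card4 (gT : finGroupType) (G : {group gT}) :
  2.-group G -> DC_group G -> ~~ cyclic G^`(1) -> #|G^`(1)| = 4.
Proof.
have [n] := ubnP #|G|; elim: n gT G => // n IHn gT G /ltnSE-leGn pG dcG ncG'.
have pG' : 2.-group G^`(1) := pgroupS (der_sub 1 G) pG.
(* Orders 1 and 2 are cyclic, order 4 is the claim, order 8 is the two-generator case; in the last
   case the order is [2 ^ k.+4]. *)
have [k oG'] := p_natP pG'; rewrite oG'; case: k oG' => [|[|[|[|k]]]] // oG'.
- by rewrite cyclic_small ?oG' in ncG'.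
- by rewrite cyclic_small ?oG' in ncG'.
- have [x [y [Gx Gy defG']]] := DC_der1_two_gen dcG.
  have sHG : <<[set x; y]>> \subset G by rewrite gen_subG subUset !sub1set Gx.
  case/negP: ncG'; rewrite defG'.
  apply: (@DC_two_gen_card8 _ <<[set x; y]>>%G x y) => //.
  - exact: DC_groupS dcG.
  - exact: pgroupS pG.
  by rewrite /= -defG' oG'.
have ntG' : G^`(1) != 1 by apply: contraNneq ncG' => ->; apply: cyclic1.
(* An involution of 'Phi(G^`(1)) can be factored out without making G^`(1)
   cyclic; if 'Phi(G^`(1)) = 1 and #|G^`(1)| > 4, any involution will do. *)
pose A := if 'Phi(G^`(1)) == 1 then G^`(1)%G else 'Phi(G^`(1))%G.
have [nsA ntA sAG'] : [/\ A <| G, A :!=: 1 & A \subset G^`(1)].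
  rewrite /A; case: ifPn => // nt; first by rewrite der_normal.
  by rewrite Phi_sub (char_normal_trans (Phi_char _) (der_normal 1 G)).
have ntAZ := meet_center_nil (pgroup_nil pG) nsA ntA.
have pAZ : 2.-group (A :&: 'Z(G)).
  exact: pgroupS (subset_trans (subsetIl _ _) (normal_sub nsA)) pG.
have [_ dv2 _] := pgroup_pdiv pAZ ntAZ.
have [z /setIP[Az Zz] oz] := Cauchy (isT : prime 2) dv2.
have nsz : <[z]> <| G by apply: sub_center_normal; rewrite cycle_subG.
have szG' : <[z]> \subset G^`(1) by rewrite cycle_subG (subsetP sAG').
have derQ : (G / <[z]>)^`(1) = G^`(1) / <[z]> by rewrite quotient_der ?normal_norm.
have oQ : #|(G / <[z]>)^`(1)| = (2 ^ k.+3)%N.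
  rewrite derQ card_quotient ?(subset_trans (der_sub 1 G)) ?normal_norm //.
  by rewrite -divgS // oG' -orderE oz expnS mulKn.
have pQ : 2.-group (G / <[z]>) := quotient_pgroup _ pG.
have ltQ : #|G / <[z]>| < n.
  apply: leq_trans leGn; rewrite ltn_quotient ?(subset_trans szG') ?der_sub //.
  by rewrite cycle_eq1; apply/eqP=> z1; rewrite z1 order1 in oz.
have /IHn : ~~ cyclic (G / <[z]>)^`(1).
  rewrite derQ; apply: contra ncG' => cycQ.
  move: Az; rewrite /A; case: ifPn => [Phi1 _ | ntPhi Phi_z].
    have abelQ : 2.-abelem (G^`(1) / <[z]>).
      by rewrite quotient_abelem // -(trivg_Phi pG').
    by move: cycQ; rewrite (abelem_cyclic abelQ) /= -derQ oQ pfactorK.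
  (* Here [z] lies in the Frattini subgroup, so the Frattini quotient of
     [G^](1)[is a quotient of the cyclic]G^[(1) / <[z]>]. *)
  apply: Phi_quotient_cyclic.
  have nsPz : <[z]> <| G^`(1) by apply: normalS nsz; rewrite ?der_sub.
  rewrite -(isog_cyclic (third_isog _ nsPz (Phi_normal _))) ?cycle_subG //.
  exact: quotient_cyclic.
(* The induction hypothesis would give the quotient a derived subgroup of order 4, yet its order is
   [2 ^ k.+3]. *)
move=> /(_ ltQ pQ (DC_quotient nsz dcG)) /=; rewrite oQ => /eqP.
by rewrite (@eqn_exp2l 2 _ 2).
Qed.

(** * Elementary abelian groups of order 4 *)

Lemma card4_noncyclic_abelem (gT : finGroupType) (G : {group gT}) :
  #|G| = 4 -> ~~ cyclic G -> 2.-abelem G.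
Proof.
move=> oG ncG; have pG : 2.-group G by rewrite /pgroup oG.
rewrite abelemE // (p2group_abelian pG) ?oG //=; apply/exponentP=> x Gx.
have /(@dvdn_pfactor 2 _ 2 isT)[k le_k2 ox] : #[x] %| 2 ^ 2.
  by rewrite -[(2 ^ 2)%N]oG order_dvdG.
rewrite leq_eqVlt in le_k2; case/predU1P: le_k2 => [k2 | lt_k2]; last first.
  by apply/eqP; rewrite -order_dvdn ox (@dvdn_exp2l 2 k 1).
case/negP: ncG; have <- : <[x]> = G; last exact: cycle_cyclic.
by apply/eqP; rewrite eqEcard cycle_subG Gx oG -orderE ox k2.
Qed.

Lemma C2xC2_abelem : 2.-abelem C2xC2.
Proof.
rewrite abelemE //; apply/andP; split.
  by apply/centsP=> -[a b] _ [c d] _; congr pair; apply: Zp_mulgC.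
apply/exponentP=> -[[[|[|a]] lta] [[|[|b]] ltb]] _ //; congr pair; exact: val_inj.
Qed.

Lemma card_C2xC2 : #|C2xC2| = 4.
Proof. by rewrite cardsT card_prod !card_ord. Qed.

(** * Sufficiency: the cyclic case and the class 3 case *)

Lemma cyclic_der1_DC (gT : finGroupType) (G : {group gT}) (p : nat) :
  p.-group G -> cyclic G^`(1) -> DC_group G.
Proof.
move=> pG cycG' H K sHG sKG.
have [sH sK] := (dergS 1 sHG, dergS 1 sKG).
(* In a cyclic group, inclusion of subgroups is divisibility of orders, and powers of one prime form
   a chain under divisibility. *)
rewrite -(cardSg_cyclic cycG' sH sK) -(cardSg_cyclic cycG' sK sH).
have [a ->] := p_natP (pgroupS (subset_trans sH (der_sub 1 G)) pG).
have [b ->] := p_natP (pgroupS (subset_trans sK (der_sub 1 G)) pG).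
by case/orP: (leq_total a b) => le_ab; [left | right]; apply: dvdn_exp2l.
Qed.

Lemma class3_der1_eq_lcn3 (gT : finGroupType) (G H : {group gT}) :
    2.-group G -> #|G^`(1)| = 4 -> nil_class G = 3 -> H \subset G ->
    H^`(1) != 1 -> H^`(1) != G^`(1) ->
  H^`(1) = 'L_3(G).
Proof.
move=> pG oG' clG sHG ntH' neqH'; have nilG := pgroup_nil pG.
have L4 : 'L_4(G) = 1 by apply/(lcn_nil_classP 3); rewrite ?clG.
have ntL3 : 'L_3(G) != 1.
  by apply/eqP=> /(lcn_nil_classP 2 nilG); rewrite clG.
have ntG' : 'L_2(G) != 1 by rewrite lcn2 -cardG_gt1 oG'.
have card2 (K : {group gT}) : K :!=: 1 -> #|K| %| 2 -> #|K| = 2.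
  rewrite -cardG_gt1 => K_gt1 dvK; apply/eqP.
  by rewrite eqn_leq dvdn_leq.
have oL3 : #|'L_3(G)| = 2.
  apply: card2 => //; rewrite -(@dvdn_pmul2l 2) // -[(2 * 2)%N]oG'.
  exact: (lcn_card_dvd pG (n := 1)).
have oH' : #|H^`(1)| = 2.
  have sH' := dergS 1 sHG.
  have := cardSg sH'; rewrite oG'.
  move=> /(@dvdn_pfactor 2 _ 2 isT)[[|[|[|k]]] // _ oH].
    by rewrite -cardG_gt1 oH in ntH'.
  by rewrite eqEcard sH' oG' oH in neqH'.
apply/eqP; apply: contraNT ntL3 => neqL3.
have tiHL : H^`(1) :&: 'L_3(G) = 1.
  rewrite prime_TIg ?oH' //; apply: contra neqL3 => sHL.
  by rewrite eqEcard sHL oL3 oH'.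
have defG' : H^`(1) * 'L_3(G) = G^`(1).
  apply/eqP; rewrite eqEcard mul_subG ?(dergS 1 sHG) ?(lcn_subS 2) //=.
  by rewrite TI_cardMg // oH' oL3 oG'.
have cL3 : G \subset 'C('L_3(G)) by rewrite centsC; apply/commG1P.
have cH' : H \subset 'C(H^`(1)).
  rewrite centsC; apply/commG1P; rewrite -(lcnSn 1).
  have /(_ ntH') := lcn_card_dvd (n := 1) (pgroupS sHG pG).
  rewrite lcn2 oH' -[X in _ %| X]muln1 dvdn_pmul2l //.
  move=> /(dvdn_leq (isT : 0 < 1)%N).
  exact: card_le1_trivg.
set C := 'C_G(G^`(1)).
have sHC : H \subset C.
  by rewrite subsetI sHG -defG' centM subsetI cH' (subset_trans sHG).
have C'cent : [~: C, C, G] = 1.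
  have e : [~: C, G, C] = 1.
    apply/commG1P; apply: (@subset_trans _ _ (mem G^`(1))).
      by rewrite commSg ?subsetIl.
    by rewrite centsC subsetIr.
  by apply: three_subgroup => //; rewrite (commGC G).
have cG'G : G^`(1) \subset 'C(G).
  rewrite -defG' mul_subG 1?centsC //.
  by rewrite centsC (subset_trans (dergS 1 sHC)) //; apply/commG1P.
by apply/eqP; rewrite lcnSn; apply/commG1P.
Qed.

Lemma class3_der1_card4_DC (gT : finGroupType) (G : {group gT}) :
  2.-group G -> #|G^`(1)| = 4 -> nil_class G = 3 -> DC_group G.
Proof.
move=> pG oG' clG H K sHG sKG.
have [-> | ntH] := eqVneq H^`(1) 1; first by left; apply: sub1G.
have [-> | ntK] := eqVneq K^`(1) 1; first by right; apply: sub1G.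
have [-> | neH] := eqVneq H^`(1) G^`(1); first by right; apply: dergS.
have [-> | neK] := eqVneq K^`(1) G^`(1); first by left; apply: dergS.
left; rewrite (class3_der1_eq_lcn3 pG oG' clG sHG ntH neH).
by rewrite (class3_der1_eq_lcn3 pG oG' clG sKG ntK neK).
Qed.

(** * Nilpotency class in the noncyclic case *)

Lemma DC_der1_card4_class3 (gT : finGroupType) (G : {group gT}) :
    2.-group G -> DC_group G -> ~~ cyclic G^`(1) -> #|G^`(1)| = 4 ->
  nil_class G = 3.
Proof.
move=> pG dcG ncG' oG'; have nilG := pgroup_nil pG.
have ntL3 : 'L_3(G) != 1.
  have [x [y [Gx Gy defG']]] := DC_der1_two_gen dcG.
  have sHG : <<[set x; y]>> \subset G by rewrite gen_subG subUset !sub1set Gx.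
  apply: contraNneq ncG' => L3; rewrite defG'.
  have L3H : 'L_3(<<[set x; y]>>) = 1 by apply/trivgP; rewrite -L3 lcnS.
  have -> := @der1_two_gen _ <<[set x; y]>>%G x y _ (erefl _) (erefl _).
  by rewrite L3H mulg1 cycle_cyclic.
(* From order 4, each further nontrivial term at least halves at the next step. *)
have L4 : 'L_4(G) = 1.
  have ntL2 : 'L_2(G) != 1 by rewrite lcn2 -cardG_gt1 oG'.
  apply: card_le1_trivg; apply: dvdn_leq => //.
  have := lcn_card_dvd (n := 1) pG ntL2.
  rewrite lcn2 oG' -[4]/(2 * 2)%N dvdn_pmul2l // => dvL3.
  have := dvdn_trans (lcn_card_dvd (n := 2) pG ntL3) dvL3.
  by rewrite -[X in _ %| X]muln1 dvdn_pmul2l.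
apply/eqP; rewrite eqn_leq; apply/andP; split; first exact/(lcn_nil_classP 3).
by rewrite ltnNge; apply: contra ntL3 => /(lcn_nil_classP 2 nilG)->.
Qed.

Theorem theorem1p3 (gT : finGroupType) (G : {group gT}) (pG : 2.-group G) :
  DC_group G <->
  (cyclic G^`(1) \/ (G^`(1) \isog C2xC2 /\ nil_class G = 3)).
Proof.
split=> [dcG | [cycG' | [isoG' clG]]].
- have [cycG' | ncG'] := boolP (cyclic G^`(1)); [by left | right].
  have oG' := DC_der1_card4 pG dcG ncG'; split.
    rewrite (isog_abelem_card _ (card4_noncyclic_abelem oG' ncG')).
    by rewrite C2xC2_abelem card_C2xC2 oG'.
  exact: DC_der1_card4_class3.
- exact: cyclic_der1_DC pG cycG'.
by apply: class3_der1_card4_DC; rewrite // (card_isog isoG') card_C2xC2.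
Qed.
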